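(* Let $a,b,c$ be smooth real-valued functions on $\mathbb{R}^m$ with $a>0$, and suppose that $$u(t,x)=a(x)t^2+b(x)t+c(x)$$ is a solution to $u_{tt}\Delta u-|\nabla u_t|^2=1$ on $\mathbb{R}\times\mathbb{R}^m$. Then $$a\equiv\text{const},\qquad \Delta b=0,\qquad \Delta c=\frac{1}{2a}\left(|\nabla b|^2+1\right)\quad\text{on }\mathbb{R}^m.$$
   Context: Here $(t,x)\in\mathbb{R}\times\mathbb{R}^m$, and the Laplacian $\Delta$ and gradient $\nabla$ are with respect to the variable $x$ only. *)

(* Defs.v *)
From mathcomp Require Import all_boot all_order all_algebra.
From mathcomp Require Import all_classical all_reals all_analysis.
Import Order.TTheory GRing.Theory Num.Theory.
Import numFieldNormedType.Exports.

Set Implicit Arguments.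
Unset Strict Implicit.
Unset Printing Implicit Defensive.

Local Open Scope classical_set_scope.
Local Open Scope ring_scope.

(* The partial derivative of f in the i-th coordinate direction; like [derive],
   it is total, and meaningful only where f is derivable in that direction. *)
Definition partial (R : realType) (m : nat) (i : 'I_m) (f : 'rV[R]_m -> R)
    : 'rV[R]_m -> R :=
  fun x => 'D_(delta_mx 0 i) f x.

Fixpoint Ck (R : realType) (m k : nat) (f : 'rV[R]_m -> R) : Prop :=
  if k is k'.+1 then
    [/\ continuous f,
        forall (i : 'I_m) (x : 'rV[R]_m), derivable f x (delta_mx 0 i)
      & forall i : 'I_m, Ck k' (partial i f)]
  else continuous f.

Definition smooth (R : realType) (m : nat) (f : 'rV[R]_m -> R) : Prop :=
  forall k : nat, Ck k f.

Definition gradient (R : realType) (m : nat) (f : 'rV[R]_m -> R)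
    (x : 'rV[R]_m) : 'rV[R]_m :=
  \row_(i < m) partial i f x.

Definition laplacian (R : realType) (m : nat) (f : 'rV[R]_m -> R)
    (x : 'rV[R]_m) : R :=
  \sum_(i < m) partial i (partial i f) x.

(* The library norm on 'rV[R]_m is the sup norm, so the squared Euclidean norm
   is spelled out. *)
Definition sqnorm2 (R : realType) (m : nat) (v : 'rV[R]_m) : R :=
  \sum_(i < m) v 0 i ^+ 2.

Definition dt (R : realType) (m : nat) (u : R -> 'rV[R]_m -> R)
    : R -> 'rV[R]_m -> R :=
  fun t x => derive1 (fun s : R => u s x) t.

(* u_tt * Laplacian(u) - |grad u_t|^2 = 1 at every (t, x), where the Laplacian
   and the gradient act on x only. *)
Definition is_solution (R : realType) (m : nat) (u : R -> 'rV[R]_m -> R)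
    : Prop :=
  forall (t : R) (x : 'rV[R]_m),
    dt (dt u) t x * laplacian (u t) x - sqnorm2 (gradient (dt u t) x) = 1.

(* Main.v *)
Require Import Defs.
From mathcomp Require Import all_boot all_order all_algebra.
From mathcomp Require Import all_classical all_reals all_analysis.
From mathcomp Require Import ring lra.
Import Order.TTheory GRing.Theory Num.Theory.
Import numFieldNormedType.Exports.
Local Open Scope classical_set_scope.
Local Open Scope ring_scope.
Set Implicit Arguments.
Unset Strict Implicit.
Unset Printing Implicit Defensive.

(** Substituting u = a t^2 + b t + c, the equation says that a polynomial of
    degree two in t is identically 1.  Its coefficients give
      a Lap(a) = 2 |grad a|^2,   a Lap(b) = 2 <grad a, grad b>,
      2 a Lap(c) = |grad b|^2 + 1
    ([quadratic_coefficients]), so everything follows once a is constant.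
    The first identity says that 1/a is harmonic, and a positive harmonic
    function on the whole space is constant.

    That Liouville theorem is obtained by Bernstein's method, which needs no
    integration, only the maximum principle.  With w = log a, the field
    g = grad w = grad a / a is curl free and satisfies div g = |g|^2.  The
    energy F = |g|^2 then satisfies Bochner's inequality ([bochner])
      m Lap(F) >= 2 F^2 + 2 m <g, grad F>,
    whose quadratic term forces F to decay.  Precisely, fix y and r, let
    s(x) = r^2 - |x - y|^2, and consider a maximum point of s^2 F on the ball
    s >= 0.  If the maximum is positive, the point is interior, so that the
    first partial derivatives of s^2 F vanish there and the second ones are
    nonpositive ([cutoff_max]); inserting this into Bochner's inequality bounds
    the maximum by a constant times r^2 ([cutoff_estimate]).  The value at the
    centre is r^4 F(y), so F(y) is at most a constant times r^-2 for
    every r > 0, and g = 0 ([liouville_field]).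

    Smoothness is expressed through iterated partial derivatives, so the
    calculus used here is one-dimensional, along coordinate lines.  The only
    genuinely several-variable ingredient is the symmetry of second derivatives
    ([derive_comm]), which makes g curl free and lets the Laplacian of g_j be
    written as the j-th derivative of div g. *)

(** * Directional derivatives along lines *)

Section Lines.
Context {R : realType} {V : normedModType R}.
Implicit Types (f : V -> R) (x v : V) (t : R).

Lemma is_derive_line f x v t (df : R) :
  is_derive (x + t *: v) v f df ->
  is_derive t (1 : R) (fun s : R => f (x + s *: v)) df.
Proof.
move=> [fd <-].
have E : (fun h : R => h^-1 *:
      (((fun s : R => f (x + s *: v)) \o shift t) (h *: (1:R)) - f (x + t *: v)))
  = (fun h : R => h^-1 *:
      ((f \o shift (x + t *: v)) (h *: v) - f (x + t *: v))).
  apply/funext => h /=; do 3 f_equal.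
  by rewrite [h *: 1]mulr1 scalerDl addrCA.
by split; rewrite /derivable /derive E.
Qed.

Lemma continuous_line x v : continuous (fun s : R => x + s *: v).
Proof.
by move=> s; apply: cvgD; [exact: cvg_cst|apply: cvgZr_tmp; exact: cvg_id].
Qed.

Lemma near_line (P : set V) x v :
  (\forall y \near x, P y) -> \forall s \near (0:R), P (x + s *: v).
Proof.
move=> Px; have := @continuous_line x v 0.
by rewrite /continuous_at scale0r addr0 => /(_ _ Px).
Qed.

Lemma MVT_line f x v t : 0 < t -> (forall y, derivable f y v) ->
  exists2 s, 0 < s < t & f (x + t *: v) - f x = 'D_v f (x + s *: v) * t.
Proof.
move=> t0 df.
have dfl s : is_derive s (1 : R) (fun s : R => f (x + s *: v)) ('D_v f (x + s *: v)).
  by apply: is_derive_line; apply: derivableP.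
have [|s] := @MVT R _ _ 0 t t0 (fun s _ => dfl s).
  by apply: derivable_within_continuous => s _; case: (dfl s).
rewrite in_itv/= scale0r addr0 subr0 => st E; by exists s.
Qed.

Lemma derive_local_max f x v : (forall y, derivable f y v) ->
  (\forall y \near x, f y <= f x) -> 'D_v f x = 0.
Proof.
move=> df fmax.
have dfl s : is_derive s (1 : R) (fun s : R => f (x + s *: v)) ('D_v f (x + s *: v)).
  by apply: is_derive_line; apply: derivableP.
have /nbhs_ballP[e/= e0 eP] := near_line v fmax.
have := @derive1_at_max R (fun s : R => f (x + s *: v)) (-e) e 0.
rewrite scale0r addr0.
case => [||||_ D0]; first by lra.
- by move=> t _; case: (dfl t).
- by rewrite in_itv/=; apply/andP; split; lra.
- move=> t; rewrite in_itv/= => te; apply: eP.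
  by rewrite /ball/= sub0r normrN ltr_norml.
- by have [_] := dfl 0; rewrite scale0r addr0 D0.
Qed.

(** If the second derivative at x were positive, the first derivative, which
    vanishes at x, would be positive just after x along v, and the mean value
    theorem would give larger values of f arbitrarily close to x. *)
Lemma derive2_local_max f x v : (forall y, derivable f y v) ->
  derivable ('D_v f) x v ->
  (\forall y \near x, f y <= f x) -> 'D_v ('D_v f) x <= 0.
Proof.
move=> df ddf fmax; rewrite leNgt; apply/negP => L0.
have D0 := derive_local_max df fmax.
have : (fun h => h^-1 *: (('D_v f \o shift x) (h *: v) - 'D_v f x)) @ 0^'
  --> 'D_v ('D_v f) x by exact: ddf.
move=> /cvgr_gt/(_ _ L0).
rewrite near_withinE => /nbhs_ballP[d/= d0 dP].
have /nbhs_ballP[e/= e0 eP] := near_line v fmax.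
pose t := Num.min d e / 2.
have m0 : 0 < Num.min d e by rewrite lt_min d0.
have t0 : 0 < t by rewrite /t; lra.
have td : t < d by rewrite /t; have := ge_min d d e; rewrite lexx /=; lra.
have te : t < e by rewrite /t; have := ge_min e d e; rewrite lexx orbT /=; lra.
have [s /andP[s0 st] E] := MVT_line x t0 df.
have : 0 < 'D_v f (x + s *: v).
  have := dP s; rewrite /ball/= sub0r normrN gtr0_norm// D0 subr0 gt_eqF//.
  move=> /(_ (lt_trans st td) isT).
  by rewrite /GRing.scale/= pmulr_rgt0 ?invr_gt0// addrC.
have := eP t; rewrite /ball/= sub0r normrN gtr0_norm// => /(_ te).
move: E; nra.
Qed.

Lemma close_values (e p q p' q' : R) :
  `|p - p'| < e / 2 -> `|q - q'| < e / 2 -> p' = q' -> `|p - q| <= e.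
Proof.
move=> + + pq'; rewrite pq' !ltr_norml ler_norml => /andP[? ?] /andP[? ?].
by apply/andP; split; lra.
Qed.

(** Symmetry of second derivatives: the mixed difference of f over a small
    parallelogram of side t, divided by t ^+ 2, is by two applications of the mean
    value theorem a value of each of the two mixed derivatives near x.  Both
    tend to their value at x, by continuity there. *)
Lemma derive_comm f x u v :
  (forall y, derivable f y u) -> (forall y, derivable f y v) ->
  (forall y, derivable ('D_u f) y v) -> (forall y, derivable ('D_v f) y u) ->
  {for x, continuous ('D_v ('D_u f))} -> {for x, continuous ('D_u ('D_v f))} ->
  'D_v ('D_u f) x = 'D_u ('D_v f) x.
Proof.
move=> fu fv fuv fvu cuv cvu.
(* The mean value theorem is applied along u' to the increment k of f in the
   direction v', then along v' to the derivative of f in the direction u'.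
   The claim is used for (u', v') = (u, v) and for (v, u): the mixed
   difference on the left is symmetric in u' and v'. *)
have mid u' v' : (forall y, derivable f y u') -> (forall y, derivable f y v') ->
  (forall y, derivable ('D_u' f) y v') -> forall t, 0 < t ->
  exists s s', [/\ 0 < s < t, 0 < s' < t &
   (f (x + t *: v' + t *: u') - f (x + t *: v')) - (f (x + t *: u') - f x) =
     'D_v' ('D_u' f) (x + s *: u' + s' *: v') * t * t].
  move=> {}fu {}fv {}fuv t t0.
  pose k y := f (y + t *: v') - f y.
  have fs y : is_derive y u' (fun z => f (z + t *: v')) ('D_u' f (y + t *: v')).
    have E : (fun h : R => h^-1 *:
          (((fun z => f (z + t *: v')) \o shift y) (h *: u') - f (y + t *: v')))
      = (fun h : R => h^-1 *:
          ((f \o shift (y + t *: v')) (h *: u') - f (y + t *: v'))).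
      by apply/funext => h /=; rewrite addrA.
    by split; rewrite /derivable /derive E//; apply: fu.
  have dk y : is_derive y u' k ('D_u' f (y + t *: v') - 'D_u' f y).
    by apply: is_deriveB; apply: derivableP.
  have [|s st Es] := @MVT_line k x u' t t0; first by move=> y; case: (dk y).
  have [s' s't Es'] := @MVT_line ('D_u' f) (x + s *: u') v' t t0 fuv.
  exists s, s'; split => //.
  have [_ dkE] := dk (x + s *: u').
  move: Es; rewrite dkE Es' /k => <-.
  by rewrite (addrAC x (t *: u')); lra.
apply/eqP; rewrite -subr_eq0 -normr_le0; apply/ler_addgt0Pl => e e0.
rewrite addr0.
have e20 : 0 < e / 2 by lra.
have near_sq (w w' : V) (k : V -> R) : {for x, continuous k} ->
   exists2 d, 0 < d & forall s s', 0 < s < d -> 0 < s' < d ->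
     `|k x - k (x + s *: w + s' *: w')| < e / 2.
  move=> ck.
  have : \forall y \near x, `|k x - k y| < e / 2 by move/cvgr_dist_lt: ck; apply.
  move=> kx.
  pose q (p : R * R) := x + p.1 *: w + p.2 *: w'.
  have cq : continuous q.
    move=> p; apply: cvgD; first apply: cvgD; first exact: cvg_cst.
      by apply: cvgZr_tmp; exact: cvg_fst.
    by apply: cvgZr_tmp; exact: cvg_snd.
  have q0 : q (0, 0) = x by rewrite /q !scale0r !addr0.
  have : \forall p \near ((0, 0) : R * R), `|k x - k (q p)| < e / 2.
    by have := cq (0, 0); rewrite /continuous_at q0 => /(_ _ kx).
  move=> /nbhs_ballP[d/= d0 dP]; exists d => // s s' /andP[s0 sd] /andP[s'0 s'd].
  apply: (dP (s, s')); split; by rewrite /ball/= sub0r normrN gtr0_norm.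
have [d1 d10 P1] := near_sq u v _ cuv.
have [d2 d20 P2] := near_sq v u _ cvu.
pose t := Num.min d1 d2 / 2.
have m0 : 0 < Num.min d1 d2 by rewrite lt_min d10.
have t0 : 0 < t by rewrite /t; lra.
have t1 : t < d1 by rewrite /t; have := ge_min d1 d1 d2; rewrite lexx /=; lra.
have t2 : t < d2 by rewrite /t; have := ge_min d2 d1 d2; rewrite lexx orbT /=; lra.
have [s1 [s1' [s1t s1't E1]]] := mid u v fu fv fuv t t0.
have [s2 [s2' [s2t s2't E2]]] := mid v u fv fu fvu t t0.
have E : 'D_v ('D_u f) (x + s1 *: u + s1' *: v) = 'D_u ('D_v f) (x + s2 *: v + s2' *: u).
  have tn0 : t != 0 by rewrite gt_eqF.
  apply: (mulIf tn0); apply: (mulIf tn0).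
  have swap (A B C D : R) : A - B - (C - D) = A - C - (B - D) by ring.
  apply: etrans (esym E1) (etrans _ E2).
  by rewrite (addrAC x (t *: u)); exact: swap.
have lt12 s' d : t < d -> 0 < s' < t -> 0 < s' < d.
  by move=> td /andP[-> /lt_trans]; apply.
by apply: close_values (P1 s1 s1' _ _) (P2 s2 s2' _ _) E; apply: lt12.
Qed.

End Lines.

(** * Partial derivatives and the classes C^k *)

Section Ck_calculus.
Context {R : realType} {m : nat}.
Implicit Types (f g : 'rV[R]_m -> R) (x : 'rV[R]_m) (i : 'I_m) (k : nat).

Lemma Ck_continuous k f : Ck k f -> continuous f.
Proof. by case: k => [|k] //= []. Qed.

Lemma Ck_derivable k f i x : Ck k.+1 f -> derivable f x (delta_mx 0 i).
Proof. by move=> [_ df _]; exact: df. Qed.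

Arguments Ck_derivable {k f i x} _.

Lemma Ck_partial k f i : Ck k.+1 f -> Ck k (partial i f).
Proof. by move=> [_ _ pf]; exact: pf. Qed.

Lemma CkW k f : Ck k.+1 f -> Ck k f.
Proof.
elim: k f => [|k IH] f; first by case.
by move=> [cf df pf]; split => // i; apply/IH/pf.
Qed.

Lemma partial_cst i (c : R) : partial i (cst c : 'rV[R]_m -> R) = cst 0.
Proof. by apply/funext => x; rewrite /partial derive_cst. Qed.

Lemma Ck_cst k (c : R) : Ck k (cst c : 'rV[R]_m -> R).
Proof.
elim: k c => [|k IH] c /=; first exact: cst_continuous.
split; [exact: cst_continuous|by move=> i x; exact: derivable_cst|].
by move=> i; rewrite partial_cst.
Qed.

Lemma partialD k l f g i : Ck k.+1 f -> Ck l.+1 g ->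
  partial i (f + g) = partial i f + partial i g.
Proof.
move=> cf cg; apply/funext => x; rewrite /partial deriveD//;
  [exact: Ck_derivable cf|exact: Ck_derivable cg].
Qed.

Lemma CkD k f g : Ck k f -> Ck k g -> Ck k (f + g).
Proof.
elim: k f g => [|k IH] f g cf cg /=.
  by move=> x; apply: continuousD; [exact: cf|exact: cg].
split.
- move=> x; apply: continuousD; [exact: (Ck_continuous cf)|exact: (Ck_continuous cg)].
- by move=> i x; apply: derivableD; [exact: Ck_derivable cf|exact: Ck_derivable cg].
- by move=> i; rewrite (partialD _ cf cg); apply: IH; exact: Ck_partial.
Qed.

Lemma Ck_sum k n (h : 'I_n -> 'rV[R]_m -> R) :
  (forall j, Ck k (h j)) -> Ck k (\sum_j h j).
Proof.
move=> hk; apply: (big_ind (Ck k)) => //; [exact: (Ck_cst k 0)|exact: CkD].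
Qed.

Lemma partial_sum k n (h : 'I_n -> 'rV[R]_m -> R) i :
  (forall j, Ck k.+1 (h j)) -> partial i (\sum_j h j) = \sum_j partial i (h j).
Proof.
move=> hk; apply/funext => x; rewrite /partial derive_sum ?fct_sumE//.
by move=> j; exact: Ck_derivable (hk j).
Qed.

Lemma partialM k l f g i : Ck k.+1 f -> Ck l.+1 g ->
  partial i (f * g) = f * partial i g + g * partial i f.
Proof.
move=> cf cg; apply/funext => x; rewrite /partial deriveM//;
  [exact: Ck_derivable cf|exact: Ck_derivable cg].
Qed.

Lemma CkM k f g : Ck k f -> Ck k g -> Ck k (f * g).
Proof.
elim: k f g => [|k IH] f g cf cg /=.
  by move=> x; apply: continuousM; [exact: cf|exact: cg].
split.
- move=> x; apply: continuousM; [exact: (Ck_continuous cf)|exact: (Ck_continuous cg)].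
- by move=> i x; apply: derivableM; [exact: Ck_derivable cf|exact: Ck_derivable cg].
- move=> i; rewrite (partialM _ cf cg); apply: CkD; apply: IH;
    by [exact: Ck_partial|exact: CkW].
Qed.

Lemma partialV k f i : Ck k.+1 f -> (forall x, f x != 0) ->
  partial i (fun x => (f x)^-1) =
  cst (-1) * ((fun x => (f x)^-1) * (fun x => (f x)^-1) * partial i f).
Proof.
move=> cf f0; apply/funext => x; rewrite /partial deriveV//; last exact: Ck_derivable cf.
by rewrite scaleNr -exprVn expr2 -[LHS]mulN1r.
Qed.

Lemma CkV k f : Ck k f -> (forall x, f x != 0) -> Ck k (fun x => (f x)^-1).
Proof.
move=> + f0; elim: k => [|k IH] cf /=.
  by move=> x; apply: continuousV => //; exact: cf.
split.
- by move=> x; apply: continuousV => //; exact: (Ck_continuous cf).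
- by move=> i x; apply: derivableV => //; exact: Ck_derivable cf.
- move=> i; rewrite (partialV _ cf f0); have ck := IH (CkW cf).
  by apply: CkM; [exact: Ck_cst|apply: CkM; [exact: CkM|exact: Ck_partial]].
Qed.

Lemma is_derive_coord (i j : 'I_m) (c : R) x :
  is_derive x (delta_mx 0 i) (fun y : 'rV[R]_m => y 0 j - c) (i == j)%:R.
Proof.
rewrite -[X in is_derive _ _ _ X]subr0; apply: is_deriveB.
have did := @derivable_id R 'rV[R]_m x (delta_mx 0 i).
split; first by have /derivable_mxP := did; apply.
have := derive_mx did; rewrite derive_id => /matrixP/(_ 0 j).
by rewrite !mxE /= => <-; rewrite eq_sym.
Qed.

Lemma partial_coord (i j : 'I_m) (c : R) :
  partial i (fun y : 'rV[R]_m => y 0 j - c) = cst (i == j)%:R.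
Proof.
by apply/funext => x; rewrite /partial; have [_ ->] := is_derive_coord i j c x.
Qed.

Lemma Ck_coord k (j : 'I_m) (c : R) : Ck k (fun y : 'rV[R]_m => y 0 j - c).
Proof.
have cX : continuous (fun y : 'rV[R]_m => y 0 j - c).
  move=> x; apply: (@continuousB _ _ _ (fun y : 'rV[R]_m => y 0 j) (cst c)).
    exact: coord_continuous.
  exact: cst_continuous.
case: k => [|k] //=; split => // [i x|i]; first by case: (is_derive_coord i j c x).
by rewrite partial_coord; exact: Ck_cst.
Qed.

Lemma partial_comm f i (j : 'I_m) : Ck 2 f ->
  partial i (partial j f) = partial j (partial i f).
Proof.
move=> f2; apply/funext => x; apply: derive_comm => [y|y|y|y||].
- exact: Ck_derivable f2.
- exact: Ck_derivable f2.
- exact: Ck_derivable (Ck_partial j f2).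
- exact: Ck_derivable (Ck_partial i f2).
- exact: (Ck_continuous (Ck_partial i (Ck_partial j f2))).
- exact: (Ck_continuous (Ck_partial j (Ck_partial i f2))).
Qed.

(** One coordinate is moved at a time: f is constant along each coordinate
    line, and x is reached from 0 by a finite chain of such moves. *)
Lemma partial_eq0_constant f : Ck 1 f -> (forall i x, partial i f x = 0) ->
  forall x, f x = f 0.
Proof.
move=> f1 f0.
have step x i t : 0 < t -> f (x + t *: delta_mx 0 i) = f x.
  move=> t0; have [|s _] := @MVT_line R _ f x (delta_mx 0 i) t t0.
    by move=> y; exact: Ck_derivable f1.
  by rewrite -/(partial i f _) f0 mul0r => /subr0_eq.
have line x i t : f (x + t *: delta_mx 0 i) = f x.
  have [t0|t0|->] := ltgtP t 0; last by rewrite scale0r addr0.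
    rewrite -(step _ i (- t)) ?oppr_gt0// -addrA -scalerDl subrr.
    by rewrite scale0r addr0.
  exact: step.
move=> x; rewrite (row_sum_delta x).
elim/big_rec: _ => // i y _ <-; by rewrite addrC line.
Qed.

End Ck_calculus.

(** * Bochner's inequality *)

Lemma add_funE (T : Type) (R : nmodType) (f g : T -> R) x : (f + g) x = f x + g x.
Proof. by []. Qed.

Lemma mul_funE (T : Type) (R : pzRingType) (f g : T -> R) x : (f * g) x = f x * g x.
Proof. by []. Qed.

(** Cauchy-Schwarz against the constant vector 1, from the nonnegativity of the
    sum of the squares of m z_i - S, where S is the sum of the z_i. *)
Lemma sqr_sum_le (R : realFieldType) (m : nat) (z : 'I_m -> R) :
  (\sum_i z i) ^+ 2 <= m%:R * \sum_i z i ^+ 2.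
Proof.
case: m z => [|m] z; first by rewrite !big_ord0 mul0r expr0n.
set S := \sum_i z i.
have : 0 <= \sum_i (m.+1%:R * z i - S) ^+ 2 by apply: sumr_ge0 => i _; exact: sqr_ge0.
have -> : \sum_i (m.+1%:R * z i - S) ^+ 2
    = m.+1%:R * (m.+1%:R * (\sum_i z i ^+ 2) - S ^+ 2).
  rewrite (eq_bigr (fun i => m.+1%:R ^+ 2 * z i ^+ 2 - (2 * m.+1%:R * S) * z i + S ^+ 2)).
    rewrite !big_split/= sumrN -!mulr_sumr -/S sumr_const card_ord -mulr_natl; ring.
  by move=> i _; ring.
by rewrite pmulr_rge0 ?ltr0n// subr_ge0.
Qed.

Definition energy (R : realType) (m : nat) (g : 'I_m -> 'rV[R]_m -> R) : 'rV[R]_m -> R :=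
  \sum_j g j * g j.

Section Bochner.
Context {R : realType} {m : nat} (g : 'I_m -> 'rV[R]_m -> R).
Hypothesis g2 : forall j, Ck 2 (g j).
Hypothesis curl : forall i j, partial i (g j) = partial j (g i).
Hypothesis div : forall x, \sum_i partial i (g i) x = \sum_i g i x ^+ 2.

Local Notation F := (energy g).

Let g1 j : Ck 1 (g j). Proof. exact: CkW. Qed.
Let dg1 i j : Ck 1 (partial i (g j)). Proof. exact: Ck_partial. Qed.

Lemma energyE x : F x = \sum_j g j x ^+ 2.
Proof. by rewrite /energy fct_sumE. Qed.

Lemma Ck_energy : Ck 2 F.
Proof. by apply: Ck_sum => j; apply: CkM. Qed.

(** By curl-freeness, d_i d_i g_j = d_i d_j g_i = d_j d_i g_i; this form exposes
    the derivatives of div g after summation over i. *)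
Lemma partial2_energy i x : partial i (partial i F) x =
  2 * \sum_j (partial i (g j) x ^+ 2 + g j x * partial j (partial i (g i)) x).
Proof.
have -> : partial i F = \sum_j (g j * partial i (g j) + g j * partial i (g j)).
  rewrite (@partial_sum _ _ 0) => [|j]; last exact: CkM.
  by apply: eq_bigr => j _; rewrite (partialM i (g1 j) (g1 j)).
rewrite (@partial_sum _ _ 0) => [|j]; last by apply: CkD; apply: CkM.
rewrite fct_sumE mulr_sumr; apply: eq_bigr => j _.
rewrite (@partialD _ _ 0 0) => [||]; try exact: CkM.
rewrite (partialM i (g1 j) (dg1 i j)).
rewrite (curl i j) (partial_comm i j (g2 i)) -(curl i j).
rewrite !(add_funE, mul_funE)/=; ring.
Qed.

(** Summing [partial2_energy] over i, the terms d_j d_i g_i add up to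
    d_j (div g) = d_j F, and the squared Jacobian is bounded below by its
    diagonal, hence by (div g)^2 / m = F^2 / m. *)
Lemma bochner x : 2 * F x ^+ 2 + 2 * m%:R * \sum_j g j x * partial j F x
  <= m%:R * laplacian F x.
Proof.
have -> : laplacian F x = 2 * (\sum_i \sum_j partial i (g j) x ^+ 2)
    + 2 * \sum_j g j x * partial j F x.
  rewrite /laplacian (eq_bigr _ (fun i _ => partial2_energy i x)) -mulr_sumr -mulrDr.
  congr (2 * _); under eq_bigr do rewrite big_split/=.
  rewrite big_split/=; congr (_ + _).
  rewrite exchange_big/=; apply: eq_bigr => j _; rewrite -mulr_sumr; congr (_ * _).
  have -> : F = \sum_i partial i (g i).
    by apply/funext => z; rewrite energyE fct_sumE div.
  by rewrite (@partial_sum _ _ 0)// fct_sumE.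
rewrite mulrDr (mulrCA m%:R) (mulrA m%:R 2) (mulrC m%:R 2) lerD2r ler_pM2l//.
rewrite energyE -div (le_trans (sqr_sum_le _))// ler_wpM2l//.
apply: ler_sum => i _; rewrite (bigD1 i)//= lerDl.
by apply: sumr_ge0 => j _; exact: sqr_ge0.
Qed.

End Bochner.

(** * The cutoff and the maximum principle *)

Section Cutoff.
Context {R : realType} {m : nat}.
Implicit Types (x y : 'rV[R]_m) (r : R) (i j : 'I_m).

(** Written with the ring operations on functions so that the product and sum
    rules for [partial] apply to it. *)
Definition cutoff r y : 'rV[R]_m -> R :=
  cst (r ^+ 2) + cst (-1) * \sum_j (fun x => x 0 j - y 0 j) * (fun x => x 0 j - y 0 j).

Lemma cutoffE r y x : cutoff r y x = r ^+ 2 - \sum_j (x 0 j - y 0 j) ^+ 2.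
Proof. by rewrite /cutoff add_funE mul_funE fct_sumE mulN1r. Qed.

Lemma Ck_cutoff k r y : Ck k (cutoff r y).
Proof.
apply: CkD; first exact: Ck_cst.
apply: CkM; first exact: Ck_cst.
by apply: Ck_sum => j; apply: CkM; exact: Ck_coord.
Qed.

Lemma partial_cutoff i r y :
  partial i (cutoff r y) = cst (-2) * (fun x => x 0 i - y 0 i).
Proof.
have X1 j : Ck 1 (fun x : 'rV[R]_m => x 0 j - y 0 j) by exact: Ck_coord.
have S1 : Ck 1 (\sum_j (fun x : 'rV[R]_m => x 0 j - y 0 j) * (fun x => x 0 j - y 0 j)).
  by apply: Ck_sum => j; exact: CkM.
rewrite /cutoff (partialD i (Ck_cst 1 _) (CkM (Ck_cst 1 _) S1)).
rewrite (partialM i (Ck_cst 1 _) S1) !partial_cst.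
rewrite (@partial_sum _ _ 0) => [|j]; last exact: CkM.
apply/funext => x; rewrite !(add_funE, mul_funE)/= !fct_sumE.
rewrite (bigD1 i)//= big1 => [|j ji]; rewrite (partialM i (X1 _) (X1 _)) partial_coord.
  by rewrite !(add_funE, mul_funE)/= eqxx mulr1n mulr1 mulr0; ring.
by rewrite !(add_funE, mul_funE)/= eq_sym (negPf ji) mulr0n mulr0 addr0.
Qed.

Lemma partial2_cutoff i r y : partial i (partial i (cutoff r y)) = cst (-2).
Proof.
rewrite partial_cutoff (partialM i (Ck_cst 1 _) (Ck_coord 1 i (y 0 i))).
rewrite partial_cst partial_coord eqxx mulr1n.
by apply/funext => x; rewrite !(add_funE, mul_funE)/=; ring.
Qed.

(** The left-hand side of the hypothesis is the first partial derivative of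
    s^2 F, with -2 X the derivative of the cutoff s. *)
Lemma cutoff_max_first (s F F1 X : R) : 0 < s ->
  s * s * F1 + F * (s * (-2 * X) + s * (-2 * X)) = 0 -> s * F1 = 4 * F * X.
Proof.
move=> s0 H; apply: (mulfI (lt0r_neq0 s0)).
by apply/eqP; rewrite -subr_eq0; apply/eqP; rewrite -[RHS]H; ring.
Qed.

(** The left-hand side of the last hypothesis is the second partial derivative
    of s^2 F as the product rule delivers it, with -2 X and -2 the derivatives of
    the cutoff s; the first order condition eliminates F1. *)
Lemma cutoff_max_second (s F F1 F2 X : R) : 0 < s -> s * F1 = 4 * F * X ->
  s * s * F2 + F1 * (s * (-2 * X) + s * (-2 * X)) +
  (F * (s * -2 + (-2 * X) * (-2 * X) + (s * -2 + (-2 * X) * (-2 * X))) +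
    (s * (-2 * X) + s * (-2 * X)) * F1) <= 0 ->
  s ^+ 2 * F2 <= F * (24 * X ^+ 2 + 4 * s).
Proof.
move=> s0 E H; rewrite -subr_le0; apply: le_trans H.
rewrite -subr_ge0 le_eqVlt; apply/orP; left; apply/eqP.
(* The two sides differ by a multiple of the first order condition. *)
transitivity ((4 * F * X - s * F1) * (8 * X)); first by rewrite E; ring.
by ring.
Qed.

(** First and second order conditions at a local maximum of s^2 F, solved for
    the derivatives of F. *)
Lemma cutoff_max r y (F : 'rV[R]_m -> R) x : Ck 2 F -> 0 < cutoff r y x ->
  (\forall z \near x, cutoff r y z * cutoff r y z * F z
     <= cutoff r y x * cutoff r y x * F x) ->
  forall i, cutoff r y x * partial i F x = 4 * F x * (x 0 i - y 0 i) /\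
    cutoff r y x ^+ 2 * partial i (partial i F) x
    <= F x * (24 * (x 0 i - y 0 i) ^+ 2 + 4 * cutoff r y x).
Proof.
move=> F2 s0 Gmax i.
pose s := cutoff r y; pose G := s * s * F.
have c2 : Ck 2 s by exact: Ck_cutoff.
have c1 : Ck 1 s by exact: Ck_cutoff.
have dc1 : Ck 1 (partial i s) by exact: Ck_partial.
have F1 : Ck 1 F by exact: CkW.
have dF1 : Ck 1 (partial i F) by exact: Ck_partial.
have cc1 : Ck 1 (s * s) by exact: CkM.
have G2 : Ck 2 G by exact: (CkM (CkM c2 c2) F2).
have G1 : Ck 1 G by exact: CkW.
have Gi : partial i G = s * s * partial i F + F * (s * partial i s + s * partial i s).
  by rewrite (partialM i cc1 F1) (partialM i c1 c1).
have h1 : Ck 1 (s * partial i s) by exact: CkM.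
have h2 : Ck 1 (s * partial i s + s * partial i s) by exact: CkD.
have Gii : partial i (partial i G) =
  (s * s * partial i (partial i F) + partial i F * (s * partial i s + s * partial i s)) +
  (F * ((s * partial i (partial i s) + partial i s * partial i s) +
        (s * partial i (partial i s) + partial i s * partial i s)) +
   (s * partial i s + s * partial i s) * partial i F).
  rewrite Gi (partialD i (CkM cc1 dF1) (CkM F1 h2)).
  rewrite (partialM i cc1 dF1) (partialM i F1 h2) (partialD i h1 h1).
  by rewrite (partialM i c1 c1) (partialM i c1 dc1).
have : partial i G x = 0 := derive_local_max (fun z => Ck_derivable G1) Gmax.
rewrite Gi partial_cutoff => /(cutoff_max_first s0) E1.
split; first exact: E1.
have : partial i (partial i G) x <= 0 := derive2_local_max
  (fun z => Ck_derivable G1) (Ck_derivable (Ck_partial i G2)) Gmax.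
rewrite Gii partial2_cutoff partial_cutoff.
exact: (cutoff_max_second s0 E1).
Qed.

End Cutoff.

(** The algebra at the maximum point, where X = x - y and L is the Laplacian of
    F.  Multiplying Bochner's inequality by s^2, using the conditions of
    [cutoff_max] and cancelling one factor f gives
      2 s^2 f + 8 m s <g, X> <= 24 m |X|^2 + 4 m^2 s.
    The drift term is absorbed by half of the leading term, because
    |s g + 4 m X|^2 >= 0. *)
Lemma cutoff_estimate (R : realFieldType) (m : nat) (s f L r : R)
    (g X F1 : 'I_m -> R) :
  0 < s -> 0 < f -> f = \sum_i g i ^+ 2 -> \sum_i X i ^+ 2 = r ^+ 2 - s ->
  (forall i, s * F1 i = 4 * f * X i) ->
  s ^+ 2 * L <= \sum_i f * (24 * X i ^+ 2 + 4 * s) ->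
  2 * f ^+ 2 + 2 * m%:R * (\sum_i g i * F1 i) <= m%:R * L ->
  s ^+ 2 * f <= (24 * m%:R + 20 * m%:R ^+ 2) * r ^+ 2.
Proof.
move=> s0 f0 fE XE F1E Lle Lge.
have X0 : 0 <= r ^+ 2 - s by rewrite -XE; apply: sumr_ge0 => i _; exact: sqr_ge0.
pose P := \sum_i g i * X i.
have PE : s * (\sum_i g i * F1 i) = 4 * f * P.
  by rewrite !mulr_sumr; apply: eq_bigr => i _; rewrite mulrCA F1E; ring.
have B : 0 <= s ^+ 2 * f + 8 * m%:R * s * P + 16 * m%:R ^+ 2 * (r ^+ 2 - s).
  have : 0 <= \sum_i (s * g i + 4 * m%:R * X i) ^+ 2.
    by apply: sumr_ge0 => i _; exact: sqr_ge0.
  congr (0 <= _); rewrite fE -XE /P !mulr_sumr -!big_split/=.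
  by apply: eq_bigr => i _; ring.
have {}Lle : s ^+ 2 * L <= f * (24 * (r ^+ 2 - s) + 4 * (m%:R * s)).
  apply: le_trans Lle _; rewrite -mulr_sumr big_split/= -mulr_sumr XE.
  by rewrite sumr_const card_ord -[X in _ + X]mulr_natl (mulrCA m%:R).
have m0 : 0 <= m%:R :> R by [].
move: (\sum_i g i * F1 i) P (m%:R : R) m0 B Lle Lge PE X0
  => {g X F1 fE XE F1E} Q P n n0 B Lle Lge PE X0.
have A : 2 * (s ^+ 2 * f) + 8 * n * s * P <= n * (24 * (r ^+ 2 - s) + 4 * (n * s)).
  rewrite -(ler_pM2l f0).
  have -> : f * (2 * (s ^+ 2 * f) + 8 * n * s * P) = s ^+ 2 * (2 * f ^+ 2 + 2 * n * Q).
    transitivity (2 * s ^+ 2 * f ^+ 2 + 2 * n * s * (4 * f * P)); first by ring.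
    by rewrite -PE; ring.
  have s20 : 0 <= s ^+ 2 by exact: sqr_ge0.
  apply: le_trans (ler_wpM2l s20 Lge) _.
  by rewrite mulrCA [leRHS]mulrCA ler_wpM2l.
have ns : 0 <= n * s by rewrite mulr_ge0 // ltW.
have nr : 0 <= n ^+ 2 * (r ^+ 2 - s) by rewrite mulr_ge0 // sqr_ge0.
nra.
Qed.

(** * Liouville's theorem for curl-free fields with div g = |g|^2 *)

Section Liouville.
Context {R : realType} {m : nat}.
Implicit Types (x y : 'rV[R]_m).

Lemma compact_cutoff_ge0 (r : R) y : 0 < r -> compact [set x | 0 <= cutoff r y x].
Proof.
move=> r0.
have box : compact [set x : 'rV[R]_m | forall i, x ord0 i \in `[y 0 i - r, y 0 i + r]].
  apply: (@rV_compact _ _ (fun i => `[y 0 i - r, y 0 i + r]%classic)).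
  by move=> i; exact: segment_compact.
apply: subclosed_compact _ box _.
  apply: (@closed_comp _ _ (cutoff r y) [set z | 0 <= z]); last exact: closed_ge.
  by move=> x _; exact: (Ck_continuous (Ck_cutoff 0 r y)).
move=> x /=; rewrite cutoffE subr_ge0 => xy i.
have : `|x 0 i - y 0 i| <= r.
  rewrite -(@ler_pXn2r _ 2)// ?nnegrE ?(ltW r0)// real_normK ?num_real//.
  apply: le_trans xy; rewrite (bigD1 i)//= lerDl.
  by apply: sumr_ge0 => j _; exact: sqr_ge0.
rewrite ler_norml in_itv/= => /andP[H1 H2]; apply/andP; split; lra.
Qed.

Variable g : 'I_m -> 'rV[R]_m -> R.
Hypothesis g2 : forall j, Ck 2 (g j).
Hypothesis curl : forall i j, partial i (g j) = partial j (g i).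
Hypothesis div : forall x, \sum_i partial i (g i) x = \sum_i g i x ^+ 2.

Local Notation F := (energy g).

(** The left-hand side is the value of s^2 F at the centre y, so it is enough to
    bound the maximum of s^2 F on the closed ball s >= 0.  If the maximum is 0
    the bound is trivial; otherwise the maximum point is interior and [cutoff_estimate]
    applies. *)
Lemma interior_estimate (r : R) y : 0 < r ->
  r ^+ 4 * F y <= (24 * m%:R + 20 * m%:R ^+ 2) * r ^+ 2.
Proof.
move=> r0; set C := 24 * m%:R + 20 * m%:R ^+ 2.
have F2 : Ck 2 F := Ck_energy g2.
pose s := cutoff r y; pose G := s * s * F.
have sc : continuous s := Ck_continuous (Ck_cutoff 0 r y).
have Gc : continuous G.
  exact: (Ck_continuous (CkM (CkM (Ck_cutoff 2 r y) (Ck_cutoff 2 r y)) F2)).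
have sy : s y = r ^+ 2.
  by rewrite /s cutoffE big1 ?subr0// => i _; rewrite subrr expr0n.
have [||x xK Gmax] := @EVT_max_rV R m G [set x | 0 <= s x] _ (@compact_cutoff_ge0 r y r0).
- by exists y; rewrite /= sy sqr_ge0.
- exact: continuous_subspaceT.
have {}Gmax z : 0 <= s z -> G z <= G x by move=> sz; apply: Gmax; rewrite inE.
have -> : r ^+ 4 * F y = G y by rewrite /G !mul_funE sy; ring.
apply: (le_trans (Gmax y _)); first by rewrite sy sqr_ge0.
have GE : G x = s x ^+ 2 * F x by rewrite /G !mul_funE; ring.
have F0 : 0 <= F x by rewrite energyE; apply: sumr_ge0 => i _; exact: sqr_ge0.
have C0 : 0 <= C * r ^+ 2 by rewrite mulr_ge0 ?sqr_ge0// addr_ge0// mulr_ge0// sqr_ge0.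
move: xK; rewrite inE/= le_eqVlt => /predU1P[s0|s0].
  by rewrite GE -s0 expr0n mul0r.
move: F0; rewrite le_eqVlt => /predU1P[F0|F0]; first by rewrite GE -F0 mulr0.
rewrite GE.
have near_pos : \forall z \near x, 0 < s z by move: (sc x) => /cvgr_gt/(_ _ s0).
have near_max : \forall z \near x, s z * s z * F z <= s x * s x * F x.
  by apply: (filterS _ near_pos) => z /ltW; exact: Gmax.
have H := cutoff_max F2 s0 near_max.
apply: (@cutoff_estimate R m (s x) (F x) (laplacian F x) r (g ^~ x)
  (fun i => x 0 i - y 0 i) (fun i => partial i F x)) => //.
- by rewrite energyE.
- by rewrite /s cutoffE; ring.
- by move=> i; have [] := H i.
- by rewrite /laplacian mulr_sumr; apply: ler_sum => i _; have [] := H i.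
- exact: bochner.
Qed.

(** Letting r tend to infinity in [interior_estimate]. *)
Lemma liouville_field j y : g j y = 0.
Proof.
pose C : R := 24 * m%:R + 20 * m%:R ^+ 2.
have F0 : F y <= 0.
  rewrite leNgt; apply/negP => F0.
  (* Any r >= 1 with r F(y) > C violates the estimate r^2 F(y) <= C. *)
  pose r := 1 + C / F y.
  have C0 : 0 <= C by rewrite addr_ge0// mulr_ge0// sqr_ge0.
  have q0 : 0 <= C / F y by rewrite divr_ge0// ltW.
  have r1 : 1 <= r by rewrite lerDl.
  have r0 : 0 < r := lt_le_trans ltr01 r1.
  have := @interior_estimate r y r0; rewrite -/C.
  rewrite (_ : r ^+ 4 * F y = (r ^+ 2 * F y) * r ^+ 2); last by ring.
  rewrite ler_pM2r ?exprn_gt0// leNgt => /negP; apply.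
  apply: (@lt_le_trans _ _ (r * F y)).
    by rewrite /r mulrDl mul1r divfK ?gt_eqF// ltrDr.
  by rewrite ler_pM2r// expr2 ler_peMl// ltW.
have := F0; rewrite energyE (bigD1 j)//= => H.
have H1 : 0 <= \sum_(i < m | i != j) g i y ^+ 2.
  by apply: sumr_ge0 => i _; exact: sqr_ge0.
apply/eqP; rewrite -sqrf_eq0 eq_le sqr_ge0 andbT.
by apply: le_trans H; rewrite lerDl.
Qed.

End Liouville.

(** * The equation for quadratic polynomials in t *)

Section Equation.
Context {R : realType} {m : nat}.
Implicit Types (f h : 'rV[R]_m -> R) (x : 'rV[R]_m).

(** The hypothesis says that 1 / f is harmonic.  The logarithmic gradient of f is
    curl free with divergence equal to its squared length, hence zero. *)
Lemma inverse_harmonic_constant f : Ck 3 f -> (forall x, 0 < f x) ->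
  (forall x, f x * laplacian f x = 2 * sqnorm2 (gradient f x)) ->
  forall x, f x = f 0.
Proof.
move=> f3 f_gt0 fE.
have f2 : Ck 2 f := CkW f3.
have f1 : Ck 1 f := CkW f2.
have f_neq0 x : f x != 0 by rewrite gt_eqF.
pose v x := (f x)^-1.
have v2 : Ck 2 v := CkV f2 f_neq0.
have v1 : Ck 1 v := CkW v2.
have df2 j : Ck 2 (partial j f) := Ck_partial j f3.
have df1 j : Ck 1 (partial j f) := CkW (df2 j).
pose g j := v * partial j f.
have g2 j : Ck 2 (g j) := CkM v2 (df2 j).
have gE j x : g j x = v x * partial j f x by [].
have dg i j x : partial i (g j) x =
    v x * partial i (partial j f) x - g i x * g j x.
  rewrite (partialM i v1 (df1 j)) (partialV i f1 f_neq0) !(add_funE, mul_funE)/=.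
  by rewrite -/(v x) !gE; ring.
have curl i j : partial i (g j) = partial j (g i).
  by apply/funext => x; rewrite !dg (partial_comm i j f2) (mulrC (g i x)).
have div x : \sum_i partial i (g i) x = \sum_i g i x ^+ 2.
  under eq_bigr do rewrite dg.
  rewrite big_split/= sumrN -mulr_sumr -/(laplacian f x).
  have -> : laplacian f x = v x * (2 * sqnorm2 (gradient f x)).
    by rewrite -fE mulrA mulVf ?mul1r.
  rewrite /sqnorm2 !mulr_sumr -sumrB; apply: eq_bigr => i _.
  by rewrite !mxE gE; ring.
apply: partial_eq0_constant => // i x.
have := liouville_field g2 curl div i x; rewrite gE => /eqP.
by rewrite mulf_eq0 invr_eq0 (negPf (f_neq0 x)) => /eqP.
Qed.

Lemma partial_affine i (k : R) f h : Ck 1 f -> Ck 1 h ->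
  partial i (cst k * f + h) = cst k * partial i f + partial i h.
Proof.
move=> f1 h1; rewrite (partialD i (CkM (Ck_cst 1 k) f1) h1).
rewrite (partialM i (Ck_cst 1 k) f1) partial_cst.
by apply/funext => x; rewrite !(add_funE, mul_funE)/= mulr0 addr0.
Qed.

Lemma laplacian_affine (k : R) f h x : Ck 2 f -> Ck 2 h ->
  laplacian (cst k * f + h) x = k * laplacian f x + laplacian h x.
Proof.
move=> f2 h2; rewrite /laplacian mulr_sumr -big_split/=; apply: eq_bigr => i _.
rewrite (partial_affine _ _ (CkW f2) (CkW h2)).
by rewrite (partial_affine _ _ (Ck_partial i f2) (Ck_partial i h2)).
Qed.

Lemma dt_quadratic (u : R -> 'rV[R]_m -> R) a b c :
  (forall t x, u t x = a x * t ^+ 2 + b x * t + c x) ->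
  forall t x, dt u t x = 2 * a x * t + b x.
Proof.
move=> uE t x; rewrite /dt derive1E.
have -> : (fun s => u s x) = cst (a x) * (id ^+ 2) + cst (b x) * id + cst (c x).
  by apply/funext => s; rewrite uE.
rewrite derive_val !scaler0 !addr0 ![_%:A]mulr1 /=.
by rewrite -mulrA mulrCA.
Qed.

(** The three coefficients of the polynomial identity in t are recovered from
    its values at t = 0, 1 and -1. *)
Lemma quadratic_coefficients (u : R -> 'rV[R]_m -> R) a b c :
  Ck 2 a -> Ck 2 b -> Ck 2 c ->
  (forall t x, u t x = a x * t ^+ 2 + b x * t + c x) -> is_solution u ->
  forall x, [/\ a x * laplacian a x = 2 * sqnorm2 (gradient a x),
    a x * laplacian b x = 2 * \sum_i partial i a x * partial i b x &
    2 * a x * laplacian c x = sqnorm2 (gradient b x) + 1].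
Proof.
move=> a2 b2 c2 uE usol x.
have u1 := dt_quadratic uE.
have u1E t : dt u t = cst (2 * t) * a + b.
  by apply/funext => z; rewrite u1 add_funE mul_funE /=; ring.
have u2 t z : dt (dt u) t z = 2 * a z.
  (* The velocity is affine in t, that is, quadratic with leading term 0. *)
  rewrite (@dt_quadratic _ (cst 0) (cst 2 * a) b); last first.
    by move=> s y; rewrite u1 /= mul_funE /=; ring.
  by rewrite /= mul_funE /=; ring.
have ut t : u t = cst (t ^+ 2) * a + (cst t * b + c).
  by apply/funext => z; rewrite uE !(add_funE, mul_funE)/=; ring.
have grad t : sqnorm2 (gradient (dt u t) x) = 4 * t ^+ 2 * sqnorm2 (gradient a x)
   + 4 * t * (\sum_i partial i a x * partial i b x) + sqnorm2 (gradient b x).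
  rewrite u1E /sqnorm2 !mulr_sumr -!big_split/=; apply: eq_bigr => i _.
  by rewrite !mxE (partial_affine _ _ (CkW a2) (CkW b2)) add_funE mul_funE /=; ring.
have eqn t : 2 * a x * (t ^+ 2 * laplacian a x + (t * laplacian b x + laplacian c x))
   - (4 * t ^+ 2 * sqnorm2 (gradient a x)
   + 4 * t * (\sum_i partial i a x * partial i b x) + sqnorm2 (gradient b x)) = 1.
  have := usol t x; rewrite u2 grad ut.
  rewrite (laplacian_affine _ _ a2 (CkD (CkM (Ck_cst 2 t) b2) c2)).
  by rewrite (laplacian_affine _ _ b2 c2).
move: (eqn 0) (eqn 1) (eqn (-1)).
move: (laplacian a x) (laplacian b x) (laplacian c x) (sqnorm2 _) (sqnorm2 _)
  (\sum_i _) (a x).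
move=> La Lb Lc A B P z {eqn u1 u1E u2 ut grad uE usol} E0 E1 E2.
split; nra.
Qed.

End Equation.

Theorem theorem7p2 (R : realType) (m : nat) (a b c : 'rV[R]_m -> R)
    (u : R -> 'rV[R]_m -> R)
    (a_smooth : smooth a) (b_smooth : smooth b) (c_smooth : smooth c)
    (a_gt0 : forall x : 'rV[R]_m, 0 < a x)
    (uE : forall (t : R) (x : 'rV[R]_m), u t x = a x * t ^+ 2 + b x * t + c x)
    (u_sol : is_solution u) :
  [/\ exists k : R, forall x : 'rV[R]_m, a x = k,
      forall x : 'rV[R]_m, laplacian b x = 0
    & forall x : 'rV[R]_m,
        laplacian c x = 1 / (2 * a x) * (sqnorm2 (gradient b x) + 1)].
Proof.
have coef := quadratic_coefficients (a_smooth 2) (b_smooth 2) (c_smooth 2) uE u_sol.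
have a_const : forall x, a x = a 0.
  by apply: inverse_harmonic_constant (a_smooth 3) a_gt0 _ => x; case: (coef x).
have a_neq0 x : a x != 0 by rewrite gt_eqF.
split; first by exists (a 0).
- move=> x; have [_ E _] := coef x.
  apply: (mulfI (a_neq0 x)); rewrite E mulr0 big1 ?mulr0// => i _.
  have -> : a = cst (a 0) by apply/funext.
  by rewrite partial_cst mul0r.
- move=> x; have [_ _ <-] := coef x.
  by rewrite mulrA div1r mulVf ?mul1r// mulf_neq0// pnatr_eq0.
Qed.
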